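(* Let $t\in\{\circ|,\ |\circ,\ +\circ\}$. Given a homogeneous regular expression $\mathcal{A}$ of type $\circ|$ of size $m$ and a homogeneous regular expression $\mathcal{B}$ of type $t$ of size $n$, one can decide whether $\mathcal{L}(\mathcal{A})\cap\mathcal{L}(\mathcal{B})\neq\emptyset$ in $\mathcal{O}(m+n)$ time.
   Context: Regular expressions are over an integer alphabet $\Sigma$ of size polynomial in the input size, built with concatenation, union $|$, Kleene plus and Kleene star, and viewed as rooted trees with letters at leaves; the size is the number of leaves. A homogeneous regexp of type $t_1t_2$ has root labelled $t_1$, all depth-1 inner nodes labelled $t_2$, whose children are leaves (children of the root may also be leaves). Thus type $\circ|$ is a concatenation $\mathcal{A}_1\cdots\mathcal{A}_k$ of nonempty sets of letters (each generating one letter); type $|\circ$ is a union $[T_1|\cdots|T_h]$ of nonempty strings; type $+\circ$ is $[T]^+$ for a nonempty string $T$, generating all concatenations of $k\ge1$ copies of $T$. *)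

(* Defs.v *)
From mathcomp Require Import all_boot.

Set Implicit Arguments.
Unset Strict Implicit.
Unset Printing Implicit Defensive.

(** * Regular expressions *)

Inductive regexp (T : Type) : Type :=
| Leaf of T
| Concat of seq (regexp T)
| Union of seq (regexp T)
| Plus of regexp T
| Star of regexp T.

Section Language.
Variable T : Type.
Implicit Types (r : regexp T) (L : seq T -> Prop).

Definition lang_cat L1 L2 : seq T -> Prop :=
  fun u => exists u1 u2, [/\ u = u1 ++ u2, L1 u1 & L2 u2].

Definition lang_pow L k : seq T -> Prop := iter k (lang_cat L) (eq [::]).

Fixpoint lang r : seq T -> Prop :=
  match r with
  | Leaf a => fun u => u = [:: a]
  | Concat rs => foldr (fun r' => lang_cat (lang r')) (eq [::]) rs
  | Union rs => foldr (fun r' L u => lang r' u \/ L u) (fun=> False) rs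
  | Plus r' => fun u => exists k, lang_pow (lang r') k.+1 u
  | Star r' => fun u => exists k, lang_pow (lang r') k u
  end.

Fixpoint re_size r : nat :=
  match r with
  | Leaf _ => 1
  | Concat rs | Union rs => sumn (map re_size rs)
  | Plus r' | Star r' => re_size r'
  end.

End Language.

(** * Homogeneous types *)

Inductive label := LConcat | LUnion | LPlus | LStar.

Section Homogeneous.
Variable T : Type.
Implicit Types (r : regexp T) (t : label).

Definition has_label t r : bool :=
  match t, r with
  | LConcat, Concat _ | LUnion, Union _ | LPlus, Plus _ | LStar, Star _ => true
  | _, _ => false
  end.

Definition is_leaf r : bool := if r is Leaf _ then true else false.

Definition children r : seq (regexp T) :=
  match r with
  | Leaf _ => [::]
  | Concat rs | Union rs => rs
  | Plus r' | Star r' => [:: r']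
  end.

(* [Concat [::]] and [Union [::]] are excluded: the leaves of an expression are
   letters, so every inner node has a child. *)
Definition inner t r : bool := has_label t r && ~~ nilp (children r).

Definition homogeneous (t : label * label) r : bool :=
  inner t.1 r &&
  all (fun r' => is_leaf r' || inner t.2 r' && all is_leaf (children r'))
      (children r).

End Homogeneous.

(** * Word RAM

    The cost is one unit per executed instruction. Words are the natural
    numbers below [2 ^ w]; all arithmetic is modulo [2 ^ w], so that the memory
    consists of the cells with addresses below [2 ^ w]. *)

Inductive arith := Add | Sub | Mul | Div | Mod.

(* Registers are numbered; [Const], [Arith] and [Read] have their destination
   register first, and [Write a r] writes register [r] at the address contained
   in register [a]. *)
Inductive instr :=
| Const of nat & nat
| Arith of arith & nat & nat & nat
| Read of nat & nat
| Write of nat & nat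
| Jump of nat
| JumpEq of nat & nat & nat
| JumpLt of nat & nat & nat
| Halt of bool.

Record state := State { pc : nat; reg : nat -> nat; mem : nat -> nat }.

Definition eval_arith (w : nat) (o : arith) (x y : nat) : nat :=
  match o with
  | Add => (x + y) %% 2 ^ w
  | Sub => (x + 2 ^ w - y) %% 2 ^ w
  | Mul => (x * y) %% 2 ^ w
  | Div => x %/ y
  | Mod => x %% y
  end.

Definition exec (w : nat) (i : instr) (s : state) : state :=
  let: State p g M := s in
  match i with
  | Const r k => State p.+1 [eta g with r |-> k %% 2 ^ w] M
  | Arith o r x y => State p.+1 [eta g with r |-> eval_arith w o (g x) (g y)] M
  | Read r a => State p.+1 [eta g with r |-> M (g a)] M
  | Write a r => State p.+1 g [eta M with g a |-> g r]
  | Jump l => State l g M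
  | JumpEq x y l => State (if g x == g y then l else p.+1) g M
  | JumpLt x y l => State (if g x < g y then l else p.+1) g M
  | Halt _ => s
  end.

(* The answer of [P] started in [s], if it halts within [k] steps. *)
Fixpoint run (w : nat) (P : seq instr) (k : nat) (s : state) : option bool :=
  if k is k'.+1 then
    match onth P (pc s) with
    | Some (Halt b) => Some b
    | Some i => run w P k' (exec w i s)
    | None => None
    end
  else None.

(* The memory beyond the input is not initialized: it contains arbitrary
   words. *)
Definition initial (w : nat) (input : seq nat) (s : state) : Prop :=
  [/\ pc s = 0,
      reg s =1 [fun _ => 0 with 0 |-> size input],
      forall i, mem s i < 2 ^ w
    & forall i, i < size input -> mem s i = nth 0 input i].

Definition decides_within (w : nat) (P : seq instr) (input : seq nat)
    (k : nat) (Q : Prop) : Prop :=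
  forall s, initial w input s -> exists2 b : bool, run w P k s = Some b & b <-> Q.

(* Preorder listing of the tree, with the label of each node and the number of
   children of the nodes of variable arity. *)
Fixpoint encode (sigma : nat) (r : regexp 'I_sigma) : seq nat :=
  match r with
  | Leaf a => [:: 0; val a]
  | Concat rs => [:: 1, size rs & flatten (map (@encode sigma) rs)]
  | Union rs => [:: 2, size rs & flatten (map (@encode sigma) rs)]
  | Plus r' => 3 :: encode r'
  | Star r' => 4 :: encode r'
  end.

(* Main.v *)
Require Import Defs.
From mathcomp Require Import all_boot zify.

(** Let [N] be the size of the input. That letter [a] belongs to the [i]-th set
    of the first expression [A] is recorded in the cell [(a + 1) * N + i]: the
    alphabet being polynomial, these cells exist, and direct addressing makes
    sorting unnecessary. The memory is not initialized, so the cells that will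
    be consulted, one per letter of [B], are first set to 0, and then those of
    the letters of [A] to 1. A concatenation of sets [B] meets [A] iff it has
    as many sets as [A] and each of them contains a marked letter; a union of
    strings meets [A] iff all letters of some string of the right length are
    marked. For [B = [T]^+] no marks are needed: the length of [T] must divide
    the number of sets of [A], and the [i]-th set must contain the letter of
    [T] at position [i] modulo the length of [T]. *)

Set Implicit Arguments.
Unset Strict Implicit.
Unset Printing Implicit Defensive.

(** * Structured code and its cost *)

Definition regs := nat -> nat.
Definition memory := nat -> nat.

(* Position-dependent code: jump targets are absolute. *)
Definition code := nat -> seq instr.

Definition block (bs : seq instr) : code := fun=> bs.

Definition cseq (c1 c2 : code) : code :=
  fun q => c1 q ++ c2 (q + size (c1 q)).

Notation "c1 ;; c2" := (cseq c1 c2) (at level 60, right associativity).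

Inductive test := EqT of nat & nat | LtT of nat & nat.

Definition jump_if (e : test) (l : nat) : instr :=
  match e with EqT x y => JumpEq x y l | LtT x y => JumpLt x y l end.

Definition test_val (e : test) (g : regs) : bool :=
  match e with EqT x y => g x == g y | LtT x y => g x < g y end.

Definition cif (e : test) (c : code) : code :=
  fun q => [:: jump_if e q.+2, Jump (q.+2 + size (c q.+2)) & c q.+2].

Definition cwhile (e : test) (c : code) : code :=
  fun q => [:: jump_if e q.+2, Jump (q.+3 + size (c q.+2))
            & c q.+2 ++ [:: Jump q]].

Definition straight (i : instr) : bool :=
  match i with Const _ _ | Arith _ _ _ _ | Read _ _ | Write _ _ => true
  | _ => false end.

Definition code_at (P : seq instr) (q : nat) (s : seq instr) : Prop :=
  exists P1 P2, P = P1 ++ s ++ P2 /\ size P1 = q.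

Lemma code_at_catl P q s1 s2 : code_at P q (s1 ++ s2) -> code_at P q s1.
Proof. by case=> P1 [P2 [-> <-]]; exists P1, (s2 ++ P2); rewrite !catA. Qed.

Lemma code_at_catr P q s1 s2 :
  code_at P q (s1 ++ s2) -> code_at P (q + size s1) s2.
Proof.
by case=> P1 [P2 [-> <-]]; exists (P1 ++ s1), P2; rewrite size_cat !catA.
Qed.

Lemma code_at_cons P q i s :
  code_at P q (i :: s) -> onth P q = Some i /\ code_at P q.+1 s.
Proof.
rewrite -cat1s => h; have := code_at_catr h; rewrite addn1; split=> //.
by case: h => P1 [P2 [-> <-]]; rewrite onth_cat ltnn subnn.
Qed.

(** * Proof rules with step counts *)

Section Wp.
Variable w : nat.
Implicit Types (g : regs) (M : memory) (Q : regs -> memory -> Prop).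

(** A triple with step bound [k]. Its equation holds for every remaining fuel [j], so that fragments
    compose without any mention of halting, and for every offset [q], so that absolute jump targets
    do no harm. *)
Definition wp (c : code) (k : nat) Q g M : Prop :=
  forall P q, code_at P q (c q) ->
  exists k' g' M', [/\ k' <= k,
    forall j, run w P (k' + j) (State q g M)
            = run w P j (State (q + size (c q)) g' M')
    & Q g' M'].

Lemma run_straight P q g M i j : straight i -> onth P q = Some i ->
  run w P j.+1 (State q g M) = run w P j (exec w i (State q g M)).
Proof. by move=> si /= ->; case: i si. Qed.

Lemma run_jump P q g M l j : onth P q = Some (Jump l) ->
  run w P j.+1 (State q g M) = run w P j (State l g M).
Proof. by move=> /= ->. Qed.

Lemma run_jump_if P q g M e l j : onth P q = Some (jump_if e l) ->
  run w P j.+1 (State q g M)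
  = run w P j (State (if test_val e g then l else q.+1) g M).
Proof. by move=> /= ->; case: e. Qed.

Lemma wp_weaken c k k' Q Q' g M :
  wp c k Q g M -> k <= k' -> (forall g' M', Q g' M' -> Q' g' M') ->
  wp c k' Q' g M.
Proof.
move=> h lek sQ P q /h [k1 [g1 [M1 [le1 r1 q1]]]]; exists k1, g1, M1.
by split=> //; [apply: leq_trans lek | apply: sQ].
Qed.

Lemma wp_leq c k k' Q g M : wp c k Q g M -> k <= k' -> wp c k' Q g M.
Proof. by move=> h lek; apply: wp_weaken h lek _. Qed.

Lemma wp_seq c1 c2 k1 k2 Q g M :
  wp c1 k1 (wp c2 k2 Q) g M -> wp (c1 ;; c2) (k1 + k2) Q g M.
Proof.
move=> h P q hc.
have [a1 [g1 [M1 [le1 r1 h2]]]] := h P q (code_at_catl hc).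
have [a2 [g2 [M2 [le2 r2 h3]]]] := h2 P _ (code_at_catr hc).
exists (a1 + a2), g2, M2; split=> //; first exact: leq_add.
by move=> j; rewrite -addnA r1 r2 /cseq size_cat addnA.
Qed.

Definition exec_block (bs : seq instr) (s : state) : state :=
  foldl (fun s i => exec w i s) s bs.

(** Straight instructions only increment the program counter, so the block may be executed
    symbolically from counter 0, and simplification then yields the final registers. *)
Lemma wp_block bs Q g M : all straight bs ->
  let s := exec_block bs (State 0 g M) in Q (reg s) (Defs.mem s) ->
  wp (block bs) (size bs) Q g M.
Proof.
move=> st /= hQ P q hc.
have run_block j : run w P (size bs + j) (State q g M)
    = run w P j (State (q + size bs)
        (reg (exec_block bs (State 0 g M))) (Defs.mem (exec_block bs (State 0 g M)))).
  have E p : exec_block bs (State p g M) = State (p + size bs)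
     (reg (exec_block bs (State 0 g M))) (Defs.mem (exec_block bs (State 0 g M))).
    elim: bs g M p {hc hQ} st => [|i bs IH] g M p /= => [_|/andP[si st]].
      by rewrite addn0.
    by case: i si => //= *; rewrite IH // [in RHS]IH // addSnnS.
  rewrite -E.
  elim: bs g M q {hQ E} st hc => [|i bs IH] g M q; first by [].
  move=> /andP[si st] /code_at_cons[o1 o2].
  rewrite [size _]/= addSn (run_straight _ _ _ si o1) /=.
  by case: i si {o1} => //= *; rewrite IH.
by do 3!eexists; split; [exact: leqnn | exact: run_block | exact: hQ].
Qed.

(** A failing test executes two jumps, a successful one only the first; 2 covers both. *)
Lemma wp_if e c k Q g M :
  (test_val e g -> wp c k Q g M) -> (~~ test_val e g -> Q g M) ->
  wp (cif e c) (k + 2) Q g M.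
Proof.
move=> ht hf P q /code_at_cons[o1] /code_at_cons[o2 hc].
case E: (test_val e g).
  have [k1 [g1 [M1 [le1 r1 q1]]]] := ht E _ _ hc.
  exists k1.+1, g1, M1; split=> // [|j]; first by rewrite addn2 ltnW.
  by rewrite addSn (run_jump_if _ _ _ o1) E r1 /= !addnS !addSn.
exists 2, g, M; split; [by rewrite leq_addl| |by apply: hf; rewrite E].
move=> j; rewrite (run_jump_if _ _ _ o1) E (run_jump _ _ _ o2).
by rewrite /= !addnS !addSn.
Qed.

(** Induction on the number of remaining iterations. The invariant is indexed by the completed ones,
    and the test must hold exactly while their number is below [n], which gives termination. An
    iteration pays 2 for its test and the jump back; the last 2 pays for the failing test and the
    exit. *)
Lemma wp_while e c (k : nat -> nat) n (I : nat -> regs -> memory -> Prop) g M :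
  (forall i g M, i <= n -> I i g M -> test_val e g = (i < n)) ->
  (forall i g M, i < n -> I i g M -> wp c (k i) (I i.+1) g M) ->
  I 0 g M -> wp (cwhile e c) (\sum_(0 <= i < n) (k i + 2) + 2) (I n) g M.
Proof.
move=> ht hc I0.
suff H i g' M' : i <= n -> I i g' M' ->
    wp (cwhile e c) (\sum_(i <= j < n) (k j + 2) + 2) (I n) g' M' by exact: H.
move=> {I0 g M}; move: g' M' => g M lein Ii.
have [d dE] : exists d, i + d = n by exists (n - i); rewrite subnKC.
elim: d i g M dE lein Ii => [|d IH] i g M dE lein Ii P q hP.
  have [o1] := code_at_cons hP; case/code_at_cons=> o2 _.
  have {dE}dE : i = n by rewrite -dE addn0.
  subst i; exists 2, g, M; split=> [||//]; first by rewrite leq_addl.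
  move=> j.
  rewrite (run_jump_if _ _ _ o1) (ht _ _ _ lein Ii) ltnn (run_jump _ _ _ o2).
  by rewrite /= size_cat /= addn1 !addnS !addSn.
have [o1] := code_at_cons hP; case/code_at_cons=> o2 hb.
have ltin : i < n by rewrite -dE addnS ltnS leq_addr.
have [k1 [g1 [M1 [le1 r1 I1]]]] := hc _ _ _ ltin Ii P _ (code_at_catl hb).
have [|//|//|k2 [g2 [M2 [le2 r2 I2]]]] := IH i.+1 g1 M1 _ _ _ P q hP.
  by rewrite addSnnS.
have /code_at_cons[o3 _] := code_at_catr hb.
exists (k1.+2 + k2), g2, M2; split=> //.
  rewrite big_ltn //; apply: leq_trans (leq_add _ le2) _; last by rewrite addnA.
  by rewrite addn2 !ltnS.
move=> j; rewrite -addnA addSnnS addSn (run_jump_if _ _ _ o1).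
by rewrite (ht _ _ _ lein Ii) ltin r1 (run_jump _ _ _ o3) r2.
Qed.

Lemma run_leq P k j s b :
  k <= j -> run w P k s = Some b -> run w P j s = Some b.
Proof.
elim: k j s => [|k IH] [|j] s //= lekj.
by case: (onth P (pc s)) => // -[] *; do ?apply: IH.
Qed.

End Wp.

(** * Traversal of an encoded expression *)

(* A child of the root: its letters, preceded in the encoding by the label and
   the arity unless the child is a single leaf. *)
Definition group := (option nat * seq nat)%type.

Definition letters_code (ls : seq nat) : seq nat :=
  flatten [seq [:: 0; a] | a <- ls].

(** The successor keeps the label of an inner node apart from 0, the label of a leaf. *)
Definition header (x : group) : seq nat :=
  if x.1 is Some tag then [:: tag.+1; size x.2] else [::].

Definition group_code (x : group) : seq nat := header x ++ letters_code x.2.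

(** Without a header nothing in the encoding tells the number of letters, which must then be 1. *)
Definition wf_group (x : group) : bool := (x.1 == None) ==> (size x.2 == 1).

Definition groups_code (gs : seq group) : seq nat :=
  flatten [seq group_code x | x <- gs].

Definition nth_letters (gs : seq group) (i : nat) : seq nat :=
  (nth (None, [::]) gs i).2.

Lemma size_letters_code ls : size (letters_code ls) = (size ls).*2.
Proof. by elim: ls => //= a ls; rewrite /letters_code /= => ->. Qed.

Lemma nth_letters_code ls j : j < size ls ->
  nth 0 (letters_code ls) j.*2.+1 = nth 0 ls j.
Proof. by elim: ls j => [|a ls IH] [|j] //= /IH. Qed.

Lemma size_group_code x :
  size (group_code x) = size (header x) + (size x.2).*2.
Proof. by rewrite size_cat size_letters_code. Qed.

Lemma size_group_code_gt x : wf_group x -> size x.2 < size (group_code x).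
Proof.
case: x => [[tag|] ls]; rewrite /wf_group size_group_code /=; first by lia.
by move=> /eqP->.
Qed.

Lemma leq_size_groups gs : all wf_group gs -> size gs <= size (groups_code gs).
Proof.
elim: gs => //= x gs IH /andP[/size_group_code_gt ltx /IH].
by rewrite /groups_code /= size_cat; lia.
Qed.

(** The code of a group has more cells than the group has letters, and at least one cell. Hence the
    fixed cost [c] and the cost [d] per letter can both be charged to these cells, even for groups
    with few letters. *)
Lemma sum_group_cost gs c d : all wf_group gs ->
  \sum_(0 <= i < size gs) (c + size (nth_letters gs i) * d)
    <= (c + d) * size (groups_code gs).
Proof.
rewrite -(big_nth (None, [::]) predT (fun x : group => c + size x.2 * d)).
elim: gs => [|x gs IH] /=; first by rewrite big_nil.
case/andP=> /size_group_code_gt ltx /IH; rewrite big_cons.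
by rewrite /groups_code /= size_cat; nia.
Qed.

(** * Positions of groups and letters in the input *)

Section Layout.
Variables (inp : seq nat) (p0 : nat) (gs : seq group) (suf : seq nat).
Hypothesis inpE : drop p0 inp = groups_code gs ++ suf.

Definition group_pos (i : nat) : nat := p0 + size (groups_code (take i gs)).

(** Address of the label of a leaf; the letter itself is in the next cell. *)
Definition letter_pos (i j : nat) : nat :=
  group_pos i + size (header (nth (None, [::]) gs i)) + j.*2.

Local Notation ls := (nth_letters gs).

Lemma group_pos0 : group_pos 0 = p0.
Proof. by rewrite /group_pos take0 addn0. Qed.

Lemma group_pos_size : group_pos (size gs) = p0 + size (groups_code gs).
Proof. by rewrite /group_pos take_size. Qed.

Lemma group_posS i : i < size gs -> group_pos i.+1 = letter_pos i (size (ls i)).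
Proof.
move=> lti; rewrite /group_pos /letter_pos (take_nth (None, [::])) //.
rewrite /groups_code map_rcons flatten_rcons size_cat size_group_code.
by rewrite /nth_letters !addnA.
Qed.

Lemma letter_posS i j : letter_pos i j.+1 = (letter_pos i j).+2.
Proof. by rewrite /letter_pos doubleS !addnS. Qed.

Lemma nth_group_code i x : i < size gs ->
  x < size (group_code (nth (None, [::]) gs i)) ->
  group_pos i + x < size inp /\
  nth 0 inp (group_pos i + x) = nth 0 (group_code (nth (None, [::]) gs i)) x.
Proof.
move=> lti; have := cat_take_drop i gs; rewrite (drop_nth (None, [::]) lti).
set y := nth _ gs i => gsE ltx; rewrite /group_pos -addnA; set s := size _.
have E : nth 0 (groups_code gs ++ suf) (s + x) = nth 0 (group_code y) x
       /\ s + x < size (groups_code gs ++ suf).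
  rewrite -{1 2}gsE /groups_code map_cat flatten_cat /= -/(groups_code _).
  move: (group_code y) ltx => c ltx; rewrite !size_cat -/s.
  rewrite -!catA nth_cat -/s ltnNge leq_addr /= addKn nth_cat ltx.
  by split=> //; lia.
rewrite -inpE nth_drop size_drop in E; case: E => -> ?; split=> //; lia.
Qed.

Lemma letter_pos_lt i j : i < size gs -> j < size (ls i) ->
  (letter_pos i j).+1 < size inp.
Proof.
move=> lti ltj; rewrite /letter_pos -addnA -addnS.
apply: (proj1 (nth_group_code lti _)).
by rewrite size_group_code; move: ltj; rewrite /nth_letters; lia.
Qed.

Lemma nth_letter i j : i < size gs -> j < size (ls i) ->
  nth 0 inp (letter_pos i j).+1 = nth 0 (ls i) j.
Proof.
move=> lti ltj; rewrite /letter_pos -addnA -addnS.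
rewrite (proj2 (nth_group_code lti _)); last first.
  by rewrite size_group_code; move: ltj; rewrite /nth_letters; lia.
by rewrite /group_code nth_cat -addnS ltnNge leq_addr /= addKn nth_letters_code.
Qed.

(** The two cases told apart by [read_header]: a positive label followed by the number of letters,
    or the label 0 of a bare leaf, which is not skipped because it belongs to the letter. *)
Lemma nth_header i : all wf_group gs -> i < size gs ->
  if (nth (None, [::]) gs i).1 is Some tag then
    [/\ (group_pos i).+1 < size inp, nth 0 inp (group_pos i) = tag.+1,
        nth 0 inp (group_pos i).+1 = size (ls i)
      & letter_pos i 0 = (group_pos i).+2]
  else [/\ group_pos i < size inp, nth 0 inp (group_pos i) = 0,
        size (ls i) = 1 & letter_pos i 0 = group_pos i].
Proof.
move=> wf_gs lti; have := nth_group_code lti.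
have := all_nthP (None, [::]) wf_gs _ lti.
rewrite /letter_pos /nth_letters /group_code /header.
case: (nth _ gs i) => -[tag|] l /= wf h.
  have [|h0 e0] := h 0; first by [].
  have [|h1 e1] := h 1; first by [].
  by move: h0 e0 h1 e1; rewrite addn0 addn1 !addn2 addn0.
case: l wf h => [|a [|b l]] // _ h.
have [|h0 e0] := h 0; first by [].
by move: h0 e0; rewrite !addn0.
Qed.

End Layout.

(* Registers: 0 input size, 1 zero, 2 one, 6 position in the input, 7 index of
   the current group, 8 its tag, 9 its number of letters, 10 index of the
   current letter, 11 that letter, 5 number of groups. The caller keeps the
   number of groups of the first expression in 3 and the address of the second
   one in 4; [pre], [body] and [post] use 12 for the current group, 13 for the
   answer, 14 for a second position in the input, and 15 as scratch. *)
Definition read_header : code :=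
  block [:: Read 8 6; Const 9 1] ;;
  cif (LtT 1 8) (block [:: Arith Add 6 6 2; Read 9 6; Arith Add 6 6 2]) ;;
  block [:: Const 10 0].

Definition read_letter : code :=
  block [:: Arith Add 6 6 2; Read 11 6; Arith Add 6 6 2].

Definition group_loop (pre body post : code) : code :=
  read_header ;; pre ;;
  cwhile (LtT 10 9) (read_letter ;; body ;; block [:: Arith Add 10 10 2]) ;;
  post ;; block [:: Arith Add 7 7 2].

Definition pass (pre body post : code) : code :=
  block [:: Const 7 0] ;; cwhile (LtT 7 5) (group_loop pre body post).

(** The bound 5 covers what is constant between passes, 6 adds the number of groups, constant during
    a pass, and 12 adds the registers of the traversal, which [pre], [body] and [post] must
    preserve. *)
Definition same n (g g' : regs) : Prop := forall x, x < n -> g' x = g x.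

Lemma same_refl n g : same n g g.
Proof. by []. Qed.

Lemma same_upd n g g' r v :
  same n g g' -> n <= r -> same n g [eta g' with r |-> v].
Proof.
by move=> sg lenr x ltx /=; rewrite sg //; case: eqP => // xr; lia.
Qed.

Lemma same_trans n g1 g2 g3 : same n g1 g2 -> same n g2 g3 -> same n g1 g3.
Proof. by move=> h12 h23 x ltx; rewrite h23 // h12. Qed.

Lemma same_le n m g g' : n <= m -> same m g g' -> same n g g'.
Proof. by move=> lenm h x ltx; apply: h; apply: leq_trans lenm. Qed.

Ltac solve_same := do ?[apply: same_upd => //].

(** * Correctness and cost of a traversal *)

Section Pass.
Variables (w : nat) (inp : seq nat) (p0 : nat) (gs : seq group) (suf : seq nat).
Hypothesis inpE : drop p0 inp = groups_code gs ++ suf.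
Hypothesis wf_gs : all wf_group gs.
Hypothesis wP : (size inp).+2 < 2 ^ w.

Local Notation ls := (nth_letters gs).
Local Notation gpos := (group_pos p0 gs).
Local Notation lpos := (letter_pos p0 gs).

Definition intact (M : memory) : Prop :=
  forall x, x < size inp -> M x = nth 0 inp x.

Variables (pre body post : code) (kpre kbody kpost : nat).
(* State at the boundary before group [i], and before letter [j] of group [i],
   in terms of the registers 12 to 14 and of the memory. *)
Variable Ug : nat -> nat -> nat -> nat -> memory -> Prop.
Variable Ul : nat -> nat -> nat -> nat -> nat -> memory -> Prop.
Variable g0 : regs.
Hypothesis g0_0 : g0 0 = size inp.
Hypothesis g0_1 : g0 1 = 0.
Hypothesis g0_2 : g0 2 = 1.
Hypothesis g0_5 : g0 5 = size gs.
Hypothesis Ug_intact : forall i f r t M, Ug i f r t M -> intact M.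
Hypothesis Ul_intact : forall i j f r t M, Ul i j f r t M -> intact M.
Hypothesis preP : forall i g M, i < size gs -> same 6 g0 g ->
  Ug i (g 12) (g 13) (g 14) M ->
  wp w pre kpre (fun g' M' => same 12 g g' /\
    Ul i 0 (g' 12) (g' 13) (g' 14) M') g M.
Hypothesis bodyP : forall i j g M, i < size gs -> j < size (ls i) ->
  same 6 g0 g -> g 7 = i -> g 10 = j -> g 11 = nth 0 (ls i) j ->
  Ul i j (g 12) (g 13) (g 14) M ->
  wp w body kbody (fun g' M' => same 12 g g' /\
    Ul i j.+1 (g' 12) (g' 13) (g' 14) M') g M.
Hypothesis postP : forall i g M, i < size gs -> same 6 g0 g ->
  g 9 = size (ls i) -> Ul i (size (ls i)) (g 12) (g 13) (g 14) M ->
  wp w post kpost (fun g' M' => same 12 g g' /\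
    Ug i.+1 (g' 12) (g' 13) (g' 14) M') g M.

(** Invariants of the loop over the groups and, in [lI], of the loop over the letters of one
    group. *)
Let gI i g M :=
  [/\ same 6 g0 g, g 6 = gpos i, g 7 = i & Ug i (g 12) (g 13) (g 14) M].

Let lI i j (g : regs) M :=
  [/\ same 6 g0 g, g 6 = lpos i j, g 7 = i /\ g 9 = size (ls i), g 10 = j
    & Ul i j (g 12) (g 13) (g 14) M].

Let g0S g x : same 6 g0 g -> x < 6 -> g x = g0 x.
Proof. by move=> h /h. Qed.

Let read_headerP i g M : i < size gs -> gI i g M ->
  wp w read_header 8 (fun g' M' => [/\ same 6 g0 g', g' 6 = lpos i 0,
    g' 7 = i /\ g' 9 = size (ls i), g' 10 = 0
    & Ug i (g' 12) (g' 13) (g' 14) M']) g M.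
Proof.
move=> lti [s6 e6 e7 u]; have hM := Ug_intact u.
have s0 := g0S s6.
have hd := nth_header inpE wf_gs lti.
have e1 : g 1 = 0 by rewrite s0.
have e2 : g 2 = 1 by rewrite s0.
have w1 : 1 %% 2 ^ w = 1 by rewrite modn_small //; lia.
apply: (@wp_seq _ _ _ 2 6); apply: wp_block => //=.
(* Register 1 being zero, the test asks whether the label is positive; if not, the number of letters
   keeps its preset value 1. *)
apply: (@wp_seq _ _ _ 5 1); apply: (wp_if (k := 3)) => /=; rewrite e1 e6.
  case: (nth _ gs i).1 hd => [tag [lt1 h0 h1 h2]|[lt1 h0 h1 h2]].
    move=> _; apply: wp_block => //=; apply: wp_block => //=.
    rewrite e2 e6 mod0n !addn1 (@modn_small (gpos i).+1); last by lia.
    rewrite modn_small; last by lia.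
    by rewrite hM // h1 h2 e7; split=> //; solve_same.
  by rewrite hM // h0.
case: (nth _ gs i).1 hd => [tag [lt1 h0 h1 h2]|[lt1 h0 h1 h2]].
  by rewrite hM ?h0 // ltnW.
move=> _; apply: wp_block => //=.
by rewrite mod0n w1 h1 h2 e6; split=> //; solve_same.
Qed.

Let loopP i g M : i < size gs -> lI i 0 g M ->
  wp w (cwhile (LtT 10 9) (read_letter ;; body ;; block [:: Arith Add 10 10 2]))
    (size (ls i) * (kbody + 6) + 2) (lI i (size (ls i))) g M.
Proof.
move=> lti l0; have -> : size (ls i) * (kbody + 6) + 2 =
    \sum_(0 <= j < size (ls i)) ((kbody + 4) + 2) + 2.
  by rewrite sum_nat_const_nat subn0 -addnA.
apply: (wp_while (I := lI i)) l0 => [j {}g {}M _|j {}g {}M ltj].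
  by case=> _ _ [_ e9] e10 _ /=; rewrite e9 e10.
case=> s6 e6 [e7 e9] e10 u; have hM := Ul_intact u.
have e2 : g 2 = 1 by rewrite s6.
have lt6 := letter_pos_lt inpE lti ltj.
apply: (@wp_leq _ _ (3 + (kbody + 1))); last by lia.
apply: wp_seq; apply: wp_block => //=.
rewrite e2 e6 !addn1 (@modn_small (lpos i j).+1); last by lia.
rewrite modn_small; last by lia.
rewrite hM // (nth_letter inpE) //.
rewrite -[kbody.+1]addn1; apply: wp_seq; set g1 := (X in wp _ _ _ _ X).
have sg1 : same 6 g0 g1 by solve_same.
apply: wp_weaken (bodyP (M := M) lti ltj sg1 e7 e10 _ u) _ _ => //.
move=> g2 M2 [s12 u2]; apply: wp_block => //=.
(* The letters occupy distinct input cells, so their index cannot overflow. *)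
have lt10 : j.+1 < 2 ^ w.
  by apply: leq_ltn_trans wP; move: lt6; rewrite /letter_pos; lia.
have f10 : g1 10 + g1 2 = j.+1 by rewrite /g1 /= e10 e2 addn1.
split=> //=; rewrite ?s12 //= ?f10 ?modn_small //.
- by solve_same; apply: same_trans sg1 (same_le _ s12).
- by rewrite letter_posS.
Qed.

Let group_loopP i g M : i < size gs -> gI i g M ->
  wp w (group_loop pre body post)
   (kpre + kpost + size (ls i) * (kbody + 6) + 11) (gI i.+1) g M.
Proof.
move=> lti gi.
apply: (@wp_leq _ _ (8 + (kpre +
   ((size (ls i) * (kbody + 6) + 2) + (kpost + 1))))); last by lia.
apply: wp_seq; apply: wp_weaken (read_headerP lti gi) _ _ => //.
move=> g1 M1 [s1 e6 [e7 e9] e10 u1].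
apply: wp_seq; apply: wp_weaken (preP lti s1 u1) _ _ => //.
move=> g2 M2 [s2 u2].
have s02 : same 6 g0 g2 by apply: same_trans s1 (same_le _ s2).
apply: wp_seq; apply: wp_weaken (loopP lti _) _ _ => //.
  by split=> //; rewrite !s2.
move=> g3 M3 [s3 f6 [f7 f9] f10 u3].
apply: wp_seq; apply: wp_weaken (postP lti s3 f9 u3) _ _ => //.
move=> g4 M4 [s4 u4]; apply: wp_block => //=.
have lt7 : i.+1 < 2 ^ w.
  by have := leq_size_groups wf_gs; have := congr1 size inpE;
     rewrite size_drop size_cat; lia.
rewrite s4 // f7 s4 // s3 // g0_2 addn1 modn_small //; split=> //=.
- by solve_same; apply: same_trans s3 (same_le _ s4).
- by rewrite s4 // f6 group_posS.
Qed.

(** Each group costs [kpre + kpost + 13] and each of its letters [kbody + 6]; charging both to the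
    cells of the code gives the constant 19. *)
Lemma wp_pass g M :
  same 6 g0 g -> g 6 = p0 -> Ug 0 (g 12) (g 13) (g 14) M ->
  wp w (pass pre body post)
    ((kpre + kbody + kpost + 19) * size (groups_code gs) + 3)
    (fun g' M' => [/\ same 6 g0 g', g' 6 = p0 + size (groups_code gs)
       & Ug (size gs) (g' 12) (g' 13) (g' 14) M']) g M.
Proof.
move=> s6 e6 u.
apply: (wp_weaken (Q := gI (size gs)) (k := 1 +
 (\sum_(0 <= i < size gs)
    (kpre + kpost + size (ls i) * (kbody + 6) + 11 + 2) + 2))).
- apply: wp_seq; apply: wp_block => //=.
  apply: (wp_while (I := gI)) => [i {u e6 s6 M}g M _|i {u e6 s6 M}g M lti|].
  + by case=> s6 _ e7 _ /=; rewrite e7 s6 // g0_5.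
  + exact: group_loopP.
  + by split=> //=; [solve_same | rewrite group_pos0 | rewrite mod0n].
- rewrite (eq_bigr (fun i => kpre + kpost + 13 + size (ls i) * (kbody + 6)));
    last by move=> i _; lia.
  have := sum_group_cost (kpre + kpost + 13) (kbody + 6) wf_gs.
  have -> : kpre + kpost + 13 + (kbody + 6) = kpre + kbody + kpost + 19 by lia.
  by lia.
- by move=> g' M' [? ? _ ?]; split=> //; rewrite -group_pos_size.
Qed.

End Pass.

(** * Marking letters *)

(* The cell marking that letter [a] is allowed at index [i < N]; these cells
   lie beyond the input, which occupies the first [N] cells. *)
Definition mark_cell (N a i : nat) : nat := a.+1 * N + i.

Lemma mark_cell_ge N a i : N <= mark_cell N a i.
Proof. by rewrite /mark_cell mulSn -addnA leq_addr. Qed.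

(** Quotient and remainder of the address by [N] recover letter and index. *)
Lemma mark_cell_inj N a b i j : i < N -> j < N ->
  mark_cell N a i = mark_cell N b j -> a = b /\ i = j.
Proof.
move=> ltiN ltjN E; have N0 : 0 < N by case: N ltiN {ltjN E}.
have /eqP := congr1 (divn^~ N) E; have /eqP := congr1 (modn^~ N) E.
rewrite /mark_cell !modnMDl !divnMDl // !modn_small // !divn_small // !addn0.
by rewrite eqSS => /eqP-> /eqP->.
Qed.

(* The index of a letter is that of its group if [b], else its position in its
   group. *)
Definition letter_mark N (b : bool) gs i j : nat :=
  mark_cell N (nth 0 (nth_letters gs i) j) (if b then i else j).

Definition group_marks N b gs i j : seq nat :=
  [seq letter_mark N b gs i j' | j' <- iota 0 j].

Definition all_marks N b gs i : seq nat :=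
  flatten [seq group_marks N b gs i' (size (nth_letters gs i')) | i' <- iota 0 i].

Lemma all_marksS N b gs i : all_marks N b gs i.+1 =
  all_marks N b gs i ++ group_marks N b gs i (size (nth_letters gs i)).
Proof.
by rewrite /all_marks -addn1 iotaD map_cat flatten_cat /= cats0.
Qed.

Lemma group_marksS N b gs i j : group_marks N b gs i j.+1 =
  rcons (group_marks N b gs i j) (letter_mark N b gs i j).
Proof. by rewrite /group_marks -addn1 iotaD map_cat cats1. Qed.

Lemma mem_all_marks N b gs x :
  reflect (exists i j, [/\ i < size gs, j < size (nth_letters gs i)
             & x = letter_mark N b gs i j])
          (x \in all_marks N b gs (size gs)).
Proof.
apply: (iffP flatten_mapP) => [[i]|[i [j [lti ltj ->]]]].
  rewrite mem_iota => lti /mapP[j]; rewrite mem_iota => ltj ->.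
  by exists i, j.
by exists i; rewrite ?mem_iota // map_f // mem_iota.
Qed.

Definition mark_addr (b : bool) : seq instr :=
  [:: Arith Add 15 11 2; Arith Mul 15 15 0;
      Arith Add 15 15 (if b then 7 else 10)].

(** With registers 1 and 2 holding 0 and 1, the choice of [r] makes this an unmarking or a marking
    pass. *)
Definition write_pass (b : bool) (r : nat) : code :=
  pass (block [::]) (block (mark_addr b ++ [:: Write 15 r])) (block [::]).

(** Cells hold 0 or 1, so that adding them up in register 12 counts the marked letters of the
    group. *)
Definition count_pass (b : bool) (post : code) : code :=
  pass (block [:: Const 12 0])
       (block (mark_addr b ++ [:: Read 15 15; Arith Add 12 12 15])) post.

(** * Correctness and cost of the marking passes *)

Section MarkPasses.
Variables (w : nat) (inp : seq nat) (p0 : nat) (gs : seq group) (suf : seq nat).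
Hypothesis inpE : drop p0 inp = groups_code gs ++ suf.
Hypothesis wf_gs : all wf_group gs.
Local Notation N := (size inp).
Local Notation ls := (nth_letters gs).
Variables (g0 : regs) (b : bool).

(** Every group and every letter takes up a cell of the input, so either kind of index is below
    [N]. *)
Lemma mark_index_lt i j : i < size gs -> j < size (ls i) ->
  (if b then i else j) < N.
Proof.
move=> lti ltj; have := letter_pos_lt inpE lti ltj.
have := leq_size_groups wf_gs; have := congr1 size inpE.
by rewrite size_drop size_cat /letter_pos; case: b; lia.
Qed.

Hypothesis wP : (size inp).+2 < 2 ^ w.
Hypothesis small : forall i j, i < size gs -> j < size (ls i) ->
  (nth 0 (ls i) j).+2 * N <= 2 ^ w.
Hypothesis g0_0 : g0 0 = N.
Hypothesis g0_1 : g0 1 = 0.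
Hypothesis g0_2 : g0 2 = 1.
Hypothesis g0_5 : g0 5 = size gs.

Lemma letter_mark_lt i j : i < size gs -> j < size (ls i) ->
  letter_mark N b gs i j < 2 ^ w.
Proof.
move=> lti ltj; apply: leq_trans (small lti ltj).
by have := mark_index_lt lti ltj; rewrite /letter_mark /mark_cell; lia.
Qed.

(** No operation wraps around: the intermediate results are bounded by the final address, which fits
    in a word. *)
Lemma mark_addrE g i j : i < size gs -> j < size (ls i) ->
  same 6 g0 g -> g 7 = i -> g 10 = j -> g 11 = nth 0 (ls i) j ->
  ((g 11 + g 2) %% 2 ^ w * g 0 %% 2 ^ w + g (if b then 7 else 10)) %% 2 ^ w
  = letter_mark N b gs i j.
Proof.
move=> lti ltj s6 e7 e10 e11; have lt := letter_mark_lt lti ltj.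
have ltN := mark_index_lt lti ltj.
rewrite (s6 2) // (s6 0) // g0_0 g0_2 e11 addn1.
have -> : g (if b then 7 else 10) = if b then i else j by case: (b).
rewrite (@modn_small (_.+1)); last first.
  by move: lt; rewrite /letter_mark /mark_cell; nia.
rewrite (@modn_small (_.+1 * N)); last first.
  by move: lt; rewrite /letter_mark /mark_cell; lia.
by rewrite modn_small.
Qed.

(** All writes go to addresses at or beyond [N], so the input being traversed stays intact. *)
Lemma wp_write_pass r g M0 : r < 6 ->
  intact inp M0 -> same 6 g0 g -> g 6 = p0 ->
  wp w (write_pass b r) (23 * size (groups_code gs) + 3)
    (fun g' M' => [/\ same 6 g0 g', g' 6 = p0 + size (groups_code gs)
       & forall x, M' x = if x \in all_marks N b gs (size gs) then g0 r
                          else M0 x]) g M0.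
Proof.
move=> ltr iM0 s6 e6.
pose U (s : seq nat) (M : memory) := M =1 (fun x => if x \in s then g0 r else M0 x).
pose Ug i (_ _ _ : nat) := U (all_marks N b gs i).
pose Ul i j (_ _ _ : nat) := U (all_marks N b gs i ++ group_marks N b gs i j).
have U0 s M : intact inp M0 -> (forall x, x \in s -> N <= x) -> U s M ->
    intact inp M.
  move=> hM hs hU x ltx; rewrite hU; case: ifP => [/hs|_]; first by lia.
  exact: hM.
have gm i j x : x \in group_marks N b gs i j -> N <= x.
  by case/mapP=> j' _ ->; apply: mark_cell_ge.
have am i x : x \in all_marks N b gs i -> N <= x.
  by case/flatten_mapP=> i' _ /gm.
apply: (wp_pass inpE wf_gs wP (kpre := 0) (kbody := 4) (kpost := 0)
  (Ug := Ug) (Ul := Ul)) => //.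
- by move=> i f r' t M; apply: U0 => // x /am.
- move=> i j f r' t M; apply: U0 => // x; rewrite mem_cat.
  by case/orP=> [/am|/gm].
- move=> i {e6 s6}g M lti s6 u; apply: wp_block => //=; split=> //.
  by rewrite /Ul cats0.
- move=> i j {e6 s6}g M lti ltj s6 e7 e10 e11 u; apply: wp_block => //=.
  split; first by solve_same.
  have -> : (if b then 7 else 10) == 15 = false by case: (b).
  rewrite (mark_addrE lti ltj s6) // => x /=.
  rewrite group_marksS -cats1 catA mem_cat inE u.
  case: (x == _) => /=; last by rewrite orbF.
  by rewrite orbT; case: eqP => [|_]; [lia | rewrite s6].
- move=> i {e6 s6}g M lti s6 e9 u; apply: wp_block => //=; split=> //.
  by rewrite /Ug all_marksS.
Qed.

(** [P i j] is the content of the cell of a letter and [R i] the answer after [i] groups; [post]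
    turns the count of a group into the next answer. *)
Lemma wp_count_pass post kpost (P : nat -> nat -> bool) (R : nat -> bool) g M :
  intact inp M ->
  (forall i j, i < size gs -> j < size (ls i) ->
     M (letter_mark N b gs i j) = P i j) ->
  (forall i g, i < size gs -> same 6 g0 g -> g 9 = size (ls i) ->
     g 12 = count (P i) (iota 0 (size (ls i))) -> g 13 = R i ->
     wp w post kpost (fun g' M' => [/\ same 12 g g', M' = M & g' 13 = R i.+1])
     g M) ->
  same 6 g0 g -> g 6 = p0 -> g 13 = R 0 ->
  wp w (count_pass b post) ((kpost + 25) * size (groups_code gs) + 3)
    (fun g' M' => same 6 g0 g' /\ g' 13 = R (size gs)) g M.
Proof.
move=> iM MP postP s6 e6 e13.
pose Ug i (_ r _ : nat) M' := M' = M /\ r = R i.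
pose Ul i j (f r _ : nat) M' :=
  [/\ M' = M, r = R i & f = count (P i) (iota 0 j)].
have -> : kpost + 25 = 1 + 5 + kpost + 19 by lia.
apply: (wp_weaken (k := (1 + 5 + kpost + 19) * size (groups_code gs) + 3));
  [ apply: (wp_pass inpE wf_gs wP (Ug := Ug) (Ul := Ul) (g0 := g0)) => // | by [] | ].
- by move=> i f r t M' [->].
- by move=> i j f r t M' [->].
- move=> i {e6 s6 e13}g M' lti s6 [-> er]; apply: wp_block => //=.
  by rewrite mod0n; split=> //; solve_same.
- move=> i j {e6 s6 e13}g M' lti ltj s6 e7 e10 e11 [-> er ef].
  apply: wp_block => //=; split; first by solve_same.
  have -> : (if b then 7 else 10) == 15 = false by case: (b).
  rewrite (mark_addrE lti ltj s6) // MP // ef; split=> //.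
  (* The count never exceeds the number of letters read, hence does not overflow. *)
  rewrite -[j.+1]addn1 iotaD count_cat /= addn0 add0n modn_small //.
  have := letter_pos_lt inpE lti ltj; have := count_size (P i) (iota 0 j).
  by rewrite size_iota /letter_pos; move: wP; case: (P i j); lia.
- move=> i {e6 s6 e13}g M' lti s6 e9 [-> er ef].
  by apply: wp_weaken (postP i g lti s6 e9 ef er) _ _ => // g' M1 [].
- by move=> g' M' [? _ []].
Qed.

Lemma wp_count_pass_all_has (P : nat -> nat -> bool) g M :
  intact inp M ->
  (forall i j, i < size gs -> j < size (ls i) ->
     M (letter_mark N b gs i j) = P i j) ->
  same 6 g0 g -> g 6 = p0 -> g 13 = 1 ->
  wp w (count_pass b (cif (LtT 12 2) (block [:: Const 13 0])))
    (28 * size (groups_code gs) + 3)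
    (fun g' M' => same 6 g0 g' /\ g' 13 =
       all (fun i => has (P i) (iota 0 (size (ls i)))) (iota 0 (size gs))) g M.
Proof.
move=> iM MP s6 e6 e13.
apply: (@wp_count_pass _ 3 P (fun i =>
  all (fun i => has (P i) (iota 0 (size (ls i)))) (iota 0 i))) => //.
move=> i {e6 s6 e13}g lti s6 e9 e12 e13.
rewrite -[i.+1]addn1 iotaD all_cat /= andbT add0n has_count -e12.
apply: (wp_if (k := 1)) => /=; rewrite (s6 2) // g0_2 ltnS leqn0 lt0n => h.
  apply: wp_block => //=; rewrite mod0n; split=> //; first by solve_same.
  by rewrite h andbF.
by rewrite e13 h andbT.
Qed.

Lemma wp_count_pass_has_all (P : nat -> nat -> bool) g M :
  intact inp M ->
  (forall i j, i < size gs -> j < size (ls i) ->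
     M (letter_mark N b gs i j) = P i j) ->
  same 6 g0 g -> g 6 = p0 -> g 13 = 0 ->
  wp w (count_pass b
      (cif (EqT 12 9) (cif (EqT 9 3) (block [:: Const 13 1]))))
    (30 * size (groups_code gs) + 3)
    (fun g' M' => same 6 g0 g' /\ g' 13 =
       has (fun i => all (P i) (iota 0 (size (ls i))) && (size (ls i) == g0 3))
         (iota 0 (size gs))) g M.
Proof.
move=> iM MP s6 e6 e13.
apply: (@wp_count_pass _ 5 P (fun i =>
  has (fun i => all (P i) (iota 0 (size (ls i))) && (size (ls i) == g0 3))
         (iota 0 i))) => //.
move=> i {e6 s6 e13}g lti s6 e9 e12 e13.
rewrite -[i.+1]addn1 iotaD has_cat /= orbF add0n all_count size_iota.
rewrite -(s6 3) // in e13 *; rewrite -e12 -{1}e9 -{1}e9.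
have w1 : 1 %% 2 ^ w = 1 by rewrite modn_small //; lia.
apply: (wp_if (k := 3)) => /= h; last by rewrite (negPf h) orbF.
apply: (wp_if (k := 1)) => /= h'; last by rewrite (negPf h') andbF orbF.
by apply: wp_block => //=; rewrite w1 h h' orbT; split=> //; solve_same.
Qed.

End MarkPasses.

(** * The three programs *)

(* Compares every group with the current letter of the string stored from
   address [g 4] on; register 14 moves along this string cyclically. *)
Definition match_pass : code :=
  pass (block [:: Const 12 0])
    (block [:: Arith Add 15 14 2; Read 15 15] ;;
     cif (EqT 15 11) (block [:: Const 12 1]))
    (cif (LtT 12 2) (block [:: Const 13 0]) ;;
     block [:: Arith Add 14 14 2; Arith Add 14 14 2] ;;
     cif (EqT 14 0) (block [:: Arith Add 14 4 1])).

(** The final value of the cyclic pointer is reported too: it encodes the number of sets modulo the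
    length of the string, from which the caller reads off divisibility. *)
Lemma wp_match_pass w inp p0 gs suf ts t0 g M :
  drop p0 inp = groups_code gs ++ suf -> all wf_group gs ->
  (size inp).+2 < 2 ^ w ->
  drop t0 inp = letters_code ts -> 0 < size ts ->
  g 0 = size inp -> g 1 = 0 -> g 2 = 1 -> g 4 = t0 -> g 5 = size gs ->
  g 6 = p0 -> g 13 = 1 -> g 14 = t0 -> intact inp M ->
  wp w match_pass (33 * size (groups_code gs) + 3)
    (fun g' M' => [/\ same 6 g g',
       g' 13 = all (fun i => nth 0 ts (i %% size ts) \in nth_letters gs i)
                 (iota 0 (size gs))
     & g' 14 = t0 + (size gs %% size ts).*2]) g M.
Proof.
move=> inpE wf_gs wP tE t_gt0 g00 g01 g02 g04 g05 e6 e13 e14 iM.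
set ok := fun i => _ \in _.
set p := size ts in t_gt0 *.
(* The string ends the input, so its end is recognized by comparing the pointer with register 0. *)
have NE : size inp = t0 + p.*2.
  by have := congr1 size tE; rewrite size_drop size_letters_code -/p; lia.
have w1 : 1 %% 2 ^ w = 1 by rewrite modn_small //; lia.
pose Ug i (_ r t : nat) M' :=
  [/\ M' = M, r = all ok (iota 0 i) & t = t0 + (i %% p).*2].
pose Ul i j (f r t : nat) M' :=
  Ug i f r t M' /\ f = (nth 0 ts (i %% p) \in take j (nth_letters gs i)).
have lt_ts i : i %% p < p by rewrite ltn_mod.
apply: (wp_weaken (k := (1 + 5 + 8 + 19) * size (groups_code gs) + 3));
  [ apply: (wp_pass inpE wf_gs wP (Ug := Ug) (Ul := Ul) (g0 := g)) => // | by []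
  | ].
- by move=> i f r t M' [->].
- by move=> i j f r t M' [[->]].
- move=> i g1 M' lti s6 [-> er et]; apply: wp_block => //=.
  by rewrite mod0n; split=> //; [solve_same | rewrite /Ul take0].
- move=> i j g1 M' lti ltj s6 e7 e10 e11 [[-> er et] ef].
  apply: (@wp_seq _ _ _ 2 3); apply: wp_block => //=.
  have lti' := lt_ts i.
  rewrite (s6 2) // g02 et addn1 modn_small; last by lia.
  rewrite iM; last by lia.
  have -> : nth 0 inp (t0 + (i %% p).*2).+1 = nth 0 ts (i %% p).
    by rewrite -addnS -nth_drop tE nth_letters_code.
  have mem_takeS x : (x \in take j.+1 (nth_letters gs i)) =
      (x \in take j (nth_letters gs i)) || (x == nth 0 (nth_letters gs i) j).
    by rewrite (take_nth 0) // mem_rcons inE orbC.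
  apply: (wp_if (k := 1)) => /=; rewrite e11 => h.
    apply: wp_block => //=; rewrite w1; split; first by solve_same.
    by rewrite /Ul mem_takeS h orbT.
  split; first by solve_same.
  by split=> //=; rewrite mem_takeS (negPf h) orbF.
- move=> i g1 M' lti s6 e9 [[-> er et] ef]; rewrite take_size in ef.
  have lti' := lt_ts i.
  (* The advance of the pointer is common to both outcomes of the preceding test. *)
  have nextP (g2 : regs) : same 12 g1 g2 -> g2 13 = all ok (iota 0 i.+1) ->
      g2 14 = g1 14 ->
      wp w (block [:: Arith Add 14 14 2; Arith Add 14 14 2] ;;
            cif (EqT 14 0) (block [:: Arith Add 14 4 1])) (2 + 3)
        (fun g' M' => same 12 g1 g' /\ Ug i.+1 (g' 12) (g' 13) (g' 14) M') g2 M.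
    move=> s12 f13 f14; apply: wp_seq; apply: wp_block => //=.
    have -> : g2 2 = 1 by rewrite s12 // s6.
    rewrite f14 et !addn1 (@modn_small (t0 + _).+1); last by lia.
    rewrite modn_small; last by lia.
    have iS : i.+1 %% p = (i %% p).+1 %% p by rewrite -addn1 -modnDml addn1.
    apply: (wp_if (k := 1)) => /=; rewrite (s12 0) // (s6 0) // g00 NE => h.
      apply: wp_block => //=; split; first by solve_same.
      split=> //=; rewrite !s12 // !s6 // g04 g01 addn0 modn_small; last by lia.
      have -> : i.+1 %% p = 0 by rewrite iS (_ : (i %% p).+1 = p) ?modnn //; lia.
      by rewrite addn0.
    split; first by solve_same.
    by split=> //=; rewrite iS (@modn_small (_.+1)); lia.
  apply: (@wp_seq _ _ _ 3 5).
  have e : all ok (iota 0 i.+1) = all ok (iota 0 i) && ok i.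
    by rewrite -[i.+1]addn1 iotaD all_cat /= andbT.
  apply: (wp_if (k := 1)) => /=; rewrite ef (s6 2) // g02 ltnS leqn0 eqb0 => h.
    apply: wp_block => //=; apply: nextP => //; first by solve_same.
    by rewrite [LHS]mod0n e /ok (negPf h) andbF.
  by apply: nextP => //; rewrite e er /ok (negbNE h) andbT.
- by rewrite /Ug mod0n addn0.
- by move=> g' M' [? _ []].
Qed.

(** Address 2 follows the label and the arity of the first expression; adding register 1, which is
    zero, is a move. *)
Definition to_first : code :=
  block [:: Arith Add 6 2 2; Arith Add 5 3 1].

Definition to_second : code :=
  block [:: Arith Add 6 4 2; Read 5 6; Arith Add 6 6 2].

(* The first marking pass is only used to find the end of the first
   expression. *)
Definition prologue : code :=
  block [:: Const 2 1; Read 3 2] ;; to_first ;; write_pass true 2 ;;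
  block [:: Arith Add 4 6 1].

(* Unmarking the cells of the second expression before marking those of the
   first makes the initial contents of the memory irrelevant. *)
Definition mark (b : bool) : code :=
  prologue ;; to_second ;; write_pass b 1 ;; to_first ;; write_pass true 2 ;;
  to_second.

(** The last two tests reject unequal numbers of sets, by one strict comparison in each
    direction. *)
Definition concat_union_prog : code :=
  mark true ;; block [:: Const 13 1] ;;
  count_pass true (cif (LtT 12 2) (block [:: Const 13 0])) ;;
  cif (LtT 5 3) (block [:: Const 13 0]) ;;
  cif (LtT 3 5) (block [:: Const 13 0]).

Definition union_concat_prog : code :=
  mark false ;; block [:: Const 13 0] ;;
  count_pass false (cif (EqT 12 9) (cif (EqT 9 3) (block [:: Const 13 1]))).

(** Register 4 is moved past the label of the plus, and past a header if there is one, to the first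
    leaf of the string. The final test rejects when the cyclic pointer is not back there. *)
Definition plus_concat_prog : code :=
  prologue ;; block [:: Arith Add 4 4 2; Read 15 4] ;;
  cif (LtT 1 15) (block [:: Arith Add 4 4 2; Arith Add 4 4 2]) ;;
  to_first ;; block [:: Const 13 1; Arith Add 14 4 1] ;; match_pass ;;
  cif (LtT 4 14) (block [:: Const 13 0]).

Definition decide (c : code) : seq instr :=
  c 0 ++ [:: JumpEq 13 2 (size (c 0)).+2; Halt false; Halt true].

Lemma run_decide w c k ans g M :
  wp w c k (fun g' M' => g' 2 = 1 /\ g' 13 = nat_of_bool ans) g M ->
  run w (decide c) (k + 2) (State 0 g M) = Some ans.
Proof.
move=> /(_ (decide c) 0)[|k' [g' [M' [lek r [e2 e13]]]]].
  by exists [::], [:: JumpEq 13 2 (size (c 0)).+2; Halt false; Halt true].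
apply: (@run_leq _ _ (k' + 2)); first by rewrite leq_add2r.
have o n : onth (decide c) (size (c 0) + n)
    = onth [:: JumpEq 13 2 (size (c 0)).+2; Halt false; Halt true] n.
  by rewrite /decide onth_cat ltnNge leq_addr addKn.
have := o 0; have := o 1; have := o 2; rewrite addn0 addn1 addn2 => o2 o1 o0.
rewrite r add0n (run_jump_if (e := EqT 13 2) _ _ _ _ o0) /= e13 e2.
by case: ans {e13}; rewrite ?o1 ?o2.
Qed.

(** * Correctness and cost of the three programs *)

Section Programs.
Variables (w : nat) (inp : seq nat) (gsA : seq group) (eB : seq nat).
Hypothesis inpE : inp = [:: 1, size gsA & groups_code gsA] ++ eB.
Hypothesis wf_A : all wf_group gsA.
Hypothesis wP : (size inp).+2 < 2 ^ w.
Local Notation N := (size inp).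
Local Notation lsA := (nth_letters gsA).
Hypothesis smallA : forall i j, i < size gsA -> j < size (lsA i) ->
  (nth 0 (lsA i) j).+2 * N <= 2 ^ w.

Local Notation startB := (2 + size (groups_code gsA)).

Definition base (g : regs) : Prop :=
  [/\ g 0 = N, g 1 = 0, g 2 = 1, g 3 = size gsA & g 4 = startB].

Let NE : N = startB + size eB.
Proof. by rewrite inpE size_cat. Qed.

Let drop2 : drop 2 inp = groups_code gsA ++ eB.
Proof. by rewrite inpE /= drop0. Qed.

Let dropB : drop startB inp = eB.
Proof. by rewrite inpE /= drop_size_cat. Qed.

Lemma base_same g g' : base g -> same 5 g g' -> base g'.
Proof. by move=> [? ? ? ? ?] s; split; rewrite s. Qed.

Let w1 : 1 %% 2 ^ w = 1.
Proof. by rewrite modn_small //; lia. Qed.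

Let size_gsA : size gsA <= size (groups_code gsA).
Proof. exact: leq_size_groups. Qed.

Lemma intact_write (s : seq nat) M M' (v : nat) :
  intact inp M -> (forall x, x \in s -> N <= x) ->
  (forall x, M' x = if x \in s then v else M x) -> intact inp M'.
Proof.
move=> hM hs hU x ltx; rewrite hU; case: ifP => [/hs|_]; first by lia.
exact: hM.
Qed.

Lemma all_marks_ge b gs i x : x \in all_marks N b gs i -> N <= x.
Proof. by case/flatten_mapP=> i' _ /mapP[j' _ ->]; apply: mark_cell_ge. Qed.

Lemma wp_to_first g M : g 1 = 0 -> g 2 = 1 -> g 3 = size gsA ->
  wp w to_first 2 (fun g' M' => [/\ same 5 g g', g' 5 = size gsA, g' 6 = 2,
    g' 13 = g 13 & M' = M]) g M.
Proof.
move=> e1 e2 e3; apply: wp_block => //=; split=> //=.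
- by solve_same.
- by rewrite e3 e1 addn0 modn_small //; lia.
- by rewrite e2 modn_small //; lia.
Qed.

Lemma wp_prologue g M : g 0 = N -> g 1 = 0 -> intact inp M ->
  wp w prologue (23 * size (groups_code gsA) + 8)
    (fun g' M' => base g' /\ intact inp M') g M.
Proof.
move=> e0 e1 iM.
apply: (@wp_leq _ _ (2 + (2 + (23 * size (groups_code gsA) + 3 + 1))));
  last by lia.
apply: wp_seq; apply: wp_block => //=; rewrite w1.
apply: wp_seq; apply: wp_weaken (wp_to_first _ _ _ _) (leqnn _) _ => //=.
  by rewrite iM ?NE // inpE.
move=> g1 _ [s5 e5 e6 _ ->]; apply: wp_seq.
have f0 : g1 0 = N by rewrite s5.
have f1 : g1 1 = 0 by rewrite s5.
have f2 : g1 2 = 1 by rewrite s5.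
apply: wp_weaken (wp_write_pass (r := 2) (b := true) drop2 wf_A wP smallA
  f0 f1 f2 e5 isT iM (@same_refl 6 g1) e6) (leqnn _) _.
move=> g2 M2 [s2 h6 hM]; apply: wp_block => //=; split.
  split=> /=; [by rewrite s2 | by rewrite s2 | by rewrite s2 | |].
    by rewrite s2 // s5 //= iM ?NE // inpE.
  by rewrite h6 s2 // f1 addn0 modn_small //; lia.
exact: intact_write iM (@all_marks_ge _ _ _) hM.
Qed.

Section TwoPasses.
Variables (gsB : seq group) (tag : nat).
Hypothesis eBE : eB = [:: tag, size gsB & groups_code gsB].
Hypothesis wf_B : all wf_group gsB.
Local Notation lsB := (nth_letters gsB).
Hypothesis smallB : forall i j, i < size gsB -> j < size (lsB i) ->
  (nth 0 (lsB i) j).+2 * N <= 2 ^ w.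

Let dropB2 : drop startB.+2 inp = groups_code gsB ++ [::].
Proof. by rewrite -addn2 addnC -drop_drop dropB eBE cats0 /= drop0. Qed.

Lemma wp_to_second g M : base g -> intact inp M ->
  wp w to_second 3 (fun g' M' => [/\ same 5 g g', g' 5 = size gsB,
    g' 6 = startB.+2 & M' = M]) g M.
Proof.
move=> [e0 e1 e2 e3 e4] iM; have sE := congr1 size eBE; rewrite /= in sE.
apply: wp_block => //=; split=> //=.
- by solve_same.
- rewrite e4 e2 addn1 modn_small; last by lia.
  rewrite iM; last by lia.
  by rewrite -[startB.+1]addn1 -nth_drop dropB eBE.
- by rewrite e4 e2 !addn1 (@modn_small startB.+1) ?modn_small //; lia.
Qed.

(** The letter must lie in the set of the first expression at index [l]: that of the group when the
    second expression is a concatenation of sets, the position in the string when it is a union of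
    strings. *)
Definition allowed (b : bool) (i j : nat) : bool :=
  let l := if b then i else j in
  (l < size gsA) && (nth 0 (lsB i) j \in lsA l).

(** By injectivity of [mark_cell], a cell shared with the first expression comes from the same
    letter at the same index. *)
Lemma letter_mark_allowed b i j : i < size gsB -> j < size (lsB i) ->
  (letter_mark N b gsB i j \in all_marks N true gsA (size gsA))
  = allowed b i j.
Proof.
move=> lti ltj; have ltN := mark_index_lt dropB2 wf_B b lti ltj.
apply/mem_all_marks/andP=> [[i' [j' [lti' ltj' E]]]|[ltl /(nthP 0)[j' ltj' E]]].
  have [||-> ->] := mark_cell_inj _ _ E; [exact: ltN| |].
    exact: (mark_index_lt drop2 wf_A true lti' ltj').
  by split=> //; apply: mem_nth.
by exists (if b then i else j), j'; split=> //; rewrite /letter_mark E.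
Qed.

Lemma wp_mark b g M : g 0 = N -> g 1 = 0 -> intact inp M ->
  wp w (mark b)
    (46 * size (groups_code gsA) + 23 * size (groups_code gsB) + 25)
    (fun g' M' => [/\ base g', g' 5 = size gsB, g' 6 = startB.+2, intact inp M'
     & forall i j, i < size gsB -> j < size (lsB i) ->
         M' (letter_mark N b gsB i j) = allowed b i j]) g M.
Proof.
move=> e0 e1 iM.
set cA := size (groups_code gsA); set cB := size (groups_code gsB).
apply: (@wp_leq _ _ ((23 * cA + 8) + (3 + ((23 * cB + 3) + (2 + ((23 * cA + 3)
   + 3)))))); last by lia.
apply: wp_seq; apply: wp_weaken (wp_prologue e0 e1 iM) (leqnn _) _.
move=> {e0 e1 iM} {}g {}M [bg iM].
apply: wp_seq; apply: wp_weaken (wp_to_second bg iM) (leqnn _) _.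
move=> g1 _ [s1 e5 e6 ->].
have bg1 := base_same bg s1; have [f0 f1 f2 f3 f4] := bg1.
apply: wp_seq; apply: wp_weaken (wp_write_pass (r := 1) (b := b) dropB2 wf_B wP
  smallB f0 f1 f2 e5 isT iM (@same_refl 6 g1) e6) (leqnn _) _.
move=> g2 M2 [s2 _ hM2].
have iM2 := intact_write iM (@all_marks_ge _ _ _) hM2.
have bg2 : base g2 by apply: base_same bg1 (same_le _ s2).
have [h0 h1 h2 h3 h4] := bg2.
apply: wp_seq; apply: wp_weaken (wp_to_first _ h1 h2 h3) (leqnn _) _.
move=> g3 _ [s3 k5 k6 _ ->].
have bg3 := base_same bg2 s3; have [k0 k1 k2 k3 k4] := bg3.
apply: wp_seq; apply: wp_weaken (wp_write_pass (r := 2) (b := true) drop2 wf_A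
  wP smallA k0 k1 k2 k5 isT iM2 (@same_refl 6 g3) k6) (leqnn _) _.
move=> g4 M4 [s4 _ hM4].
have iM4 := intact_write iM2 (@all_marks_ge _ _ _) hM4.
have bg4 : base g4 by apply: base_same bg3 (same_le _ s4).
apply: wp_weaken (wp_to_second bg4 iM4) (leqnn _) _.
move=> g5 _ [s5 l5 l6 ->]; split=> //; first exact: base_same bg4 s5.
move=> i j lti ltj; rewrite hM4 letter_mark_allowed //.
(* A cell marked for the first expression holds 1. Any other cell considered here belongs to the
   second one and was set to 0 by the earlier write pass. *)
case: ifP => _; first exact: k2.
rewrite hM2 ifT; first exact: f1.
by apply/mem_all_marks; exists i, j.
Qed.

Lemma wp_concat_union_prog g M : g 0 = N -> g 1 = 0 -> intact inp M ->
  wp w concat_union_prog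
    (46 * size (groups_code gsA) + 51 * size (groups_code gsB) + 40)
    (fun g' M' => g' 2 = 1 /\ g' 13 = ((size gsA == size gsB) &&
       all (fun i => has (allowed true i) (iota 0 (size (lsB i))))
         (iota 0 (size gsB)))) g M.
Proof.
move=> e0 e1 iM.
set cA := size (groups_code gsA); set cB := size (groups_code gsB).
apply: (@wp_leq _ _ ((46 * cA + 23 * cB + 25) + (1 + ((28 * cB + 3) + (3 + 3)))));
  last by lia.
apply: wp_seq; apply: wp_weaken (wp_mark (b := true) e0 e1 iM) (leqnn _) _.
move=> {e0 e1 iM} {}g {}M [[e0 e1 e2 e3 e4] e5 e6 iM hM].
apply: wp_seq; apply: wp_block => //=; rewrite w1.
set g1 := (X in wp _ _ _ _ X).
apply: wp_seq; apply: wp_weaken (wp_count_pass_all_has (g0 := g1) dropB2 wf_B wP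
  smallB e0 e1 e2 e5 iM hM (@same_refl 6 g1) e6 erefl) (leqnn _) _.
set ans := all _ _ => g2 M2 [s2 e13].
have [h2 h3 h5] : [/\ g2 2 = 1, g2 3 = size gsA & g2 5 = size gsB].
  by rewrite !s2.
apply: wp_seq; apply: (wp_if (k := 1)) => /=; rewrite h3 h5 => lt1.
  apply: wp_block => //=; apply: (wp_if (k := 1)) => /= lt2.
    by rewrite h3 h5 in lt2; lia.
  by rewrite mod0n gtn_eqF.
apply: (wp_if (k := 1)) => /=; rewrite h3 h5 => lt2.
  by apply: wp_block => //=; rewrite mod0n ltn_eqF.
by rewrite e13 (_ : _ == _) //; lia.
Qed.

Lemma wp_union_concat_prog g M : g 0 = N -> g 1 = 0 -> intact inp M ->
  wp w union_concat_prog
    (46 * size (groups_code gsA) + 53 * size (groups_code gsB) + 40)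
    (fun g' M' => g' 2 = 1 /\ g' 13 =
       has (fun i => all (allowed false i) (iota 0 (size (lsB i)))
              && (size (lsB i) == size gsA)) (iota 0 (size gsB))) g M.
Proof.
move=> e0 e1 iM.
set cA := size (groups_code gsA); set cB := size (groups_code gsB).
apply: (@wp_leq _ _ ((46 * cA + 23 * cB + 25) + (1 + (30 * cB + 3))));
  last by lia.
apply: wp_seq; apply: wp_weaken (wp_mark (b := false) e0 e1 iM) (leqnn _) _.
move=> {e0 e1 iM} {}g {}M [[e0 e1 e2 e3 e4] e5 e6 iM hM].
apply: wp_seq; apply: wp_block => //=; rewrite mod0n.
set g1 := (X in wp _ _ _ _ X).
apply: wp_weaken (wp_count_pass_has_all (g0 := g1) dropB2 wf_B wP
  smallB e0 e1 e2 e5 iM hM (@same_refl 6 g1) e6 erefl) (leqnn _) _.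
move=> g2 M2 [s2 ->]; rewrite s2 //; split=> //=.
by congr nat_of_bool; apply: eq_has => i; rewrite /g1 /= e3.
Qed.

End TwoPasses.

Section PlusConcat.
Variables (tag : nat) (x : group).
Hypothesis eBE : eB = tag :: group_code x.
Hypothesis wf_x : wf_group x.
Hypothesis x_gt0 : 0 < size x.2.

Lemma wp_plus_concat_prog g M : g 0 = N -> g 1 = 0 -> intact inp M ->
  wp w plus_concat_prog (56 * size (groups_code gsA) + 40)
    (fun g' M' => g' 2 = 1 /\ g' 13 = ((size x.2 %| size gsA) &&
      all (fun i => nth 0 x.2 (i %% size x.2) \in lsA i)
        (iota 0 (size gsA)))) g M.
Proof.
move=> e0 e1 iM.
set cA := size (groups_code gsA).
apply: (@wp_leq _ _ ((23 * cA + 8) + (2 + (4 + (2 + (2 + ((33 * cA + 3) + 3)))))));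
  last by lia.
apply: wp_seq; apply: wp_weaken (wp_prologue e0 e1 iM) (leqnn _) _.
move=> {e0 e1 iM} {}g {}M [[e0 e1 e2 e3 e4] iM].
have sE := congr1 size eBE; rewrite /= in sE.
(* First leaf of the string, after the label of the plus and the header. *)
pose t0 := startB.+1 + size (header x).
have tE : drop t0 inp = letters_code x.2.
  rewrite /t0 [_.+1 + _]addSnnS [_ + _.+1]addnC -drop_drop dropB eBE /= /group_code.
  by rewrite drop_size_cat.
have NEt : N = t0 + (size x.2).*2.
  by rewrite NE sE size_group_code /t0; lia.
apply: (@wp_seq _ _ _ 2); apply: wp_block => //=.
rewrite e4 e2 addn1 modn_small; last by lia.
set g1 := (X in wp _ _ _ _ X).
have headP : wp w (cif (LtT 1 15) (block [:: Arith Add 4 4 2; Arith Add 4 4 2]))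
  4 (fun g' M' => [/\ g' 0 = N, g' 1 = 0, g' 2 = 1, g' 3 = size gsA
        & g' 4 = t0] /\ M' = M) g1 M.
  have f15 : g1 15 = nth 0 (group_code x) 0.
    rewrite /g1 /= iM; last by lia.
    by rewrite -[startB.+1]addn1 -nth_drop dropB eBE.
  apply: (wp_if (k := 2)) => /=; rewrite f15 [g1 1]e1 lt0n /t0 => h.
    apply: wp_block => //=; split=> //; split=> //=.
    have [-> ->] : g1 2 = 1 /\ g1 4 = startB.+1 by rewrite /g1 /= e2.
    move: h NEt wP; rewrite /t0 /group_code /header.
    case: (x.1) => [tg|] /= h NEt wP'.
      by rewrite !addn1 (@modn_small startB.+2) ?modn_small; lia.
    by case: (x.2) h x_gt0.
  split=> //; split=> //=; move: h; rewrite /group_code /header.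
  by case: (x.1) => [tg|] //=; rewrite addn0.
apply: wp_seq; apply: wp_weaken headP (leqnn _) _.
move=> g2 _ [[f0 f1 f2 f3 f4] ->].
apply: wp_seq; apply: wp_weaken (wp_to_first _ f1 f2 f3) (leqnn _) _.
move=> g3 _ [s3 k5 k6 _ ->].
apply: wp_seq; apply: wp_block => //=; rewrite w1.
have [k0 k1 k2 k4] : [/\ g3 0 = N, g3 1 = 0, g3 2 = 1 & g3 4 = t0].
  by rewrite !s3.
rewrite k4 k1 addn0 modn_small; last by lia.
apply: wp_seq; apply: wp_weaken (wp_match_pass drop2 wf_A wP tE x_gt0 _ _ _ _ _
   _ _ _ iM) (leqnn _) _ => //=.
set ans := all _ _ => g4 M4 [s4 e13 e14].
(* The pointer lies beyond [t0] exactly when the remainder is nonzero. *)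
apply: (wp_if (k := 1)) => /=; rewrite e14 s4 //= k4 -{1}[t0]addn0 ltn_add2l.
  move=> h; apply: wp_block => //=; rewrite s4 // mod0n; split=> //.
  by rewrite /dvdn gtn_eqF //; lia.
by move=> h; rewrite s4 // e13 (_ : _ %| _) // /dvdn; lia.
Qed.

End PlusConcat.

End Programs.

(** * Languages of homogeneous expressions *)

Lemma mem_iota0 n i : (i \in iota 0 n) = (i < n).
Proof. by rewrite mem_iota. Qed.

(** Membership in the product of the sets, over the plain numbers that the machine sees. *)
Definition matches (s : seq nat) (gs : seq group) : bool :=
  all2 (fun a (x : group) => a \in x.2) s gs.

Lemma matchesP s gs :
  reflect (size s = size gs
           /\ forall i, i < size gs -> nth 0 s i \in nth_letters gs i)
          (matches s gs).
Proof.
elim: s gs => [|a s IH] [|x gs] /=; try by constructor; case.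
  by constructor.
apply: (iffP andP) => [[ax /IH[-> h]]|[[sE] h]].
  by split=> // -[|i] //= lti; apply: h.
by split; [apply: (h 0) | apply/IH; split=> // i lti; apply: (h i.+1)].
Qed.

Lemma nth_flatten_nseq (s : seq nat) k i : i < k * size s ->
  nth 0 (flatten (nseq k s)) i = nth 0 s (i %% size s).
Proof.
elim: k i => //= k IH i; rewrite mulSn nth_cat => lti.
case: (ltnP i (size s)) => [lt|ge]; first by rewrite modn_small.
by rewrite IH; [rewrite -modnDr (subnK ge) | lia].
Qed.

Lemma size_flatten_nseq (s : seq nat) k : size (flatten (nseq k s)) = k * size s.
Proof. by elim: k => //= k IH; rewrite size_cat IH mulSn. Qed.

(** * Computed answers and common strings *)

Section Answers.
Variables (gsA gsB : seq group).
Local Notation lsA := (nth_letters gsA).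
Local Notation lsB := (nth_letters gsB).

Lemma matches_both :
  (exists s, matches s gsA /\ matches s gsB) <->
  (size gsA == size gsB) &&
    all (fun i => has (allowed gsA gsB true i) (iota 0 (size (lsB i))))
      (iota 0 (size gsB)).
Proof.
split=> [[s [/matchesP[sA hA] /matchesP[sB hB]]]|/andP[/eqP sE /allP h]].
  rewrite -sA sB eqxx /=; apply/allP=> i; rewrite mem_iota0 => lti.
  have /(nthP 0)[j ltj jE] := hB _ lti.
  apply/hasP; exists j; rewrite ?mem_iota0 // /allowed jE.
  by rewrite -sA sB lti hA // -sA sB.
(* The common string takes from each set of the second expression its first letter that also lies in
   the corresponding set of the first. *)
pose f i := nth 0 (lsB i) (find (fun a => a \in lsA i) (lsB i)).
have hf i : i < size gsB -> f i \in lsA i /\ f i \in lsB i.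
  move=> lti; have /h/hasP[j] : i \in iota 0 (size gsB) by rewrite mem_iota0.
  rewrite mem_iota0 => ltj /andP[_ jA].
  have hs : has (fun a => a \in lsA i) (lsB i).
    by apply/hasP; exists (nth 0 (lsB i) j) => //; apply: mem_nth.
  by split; [apply: (nth_find 0 hs) | rewrite mem_nth // -has_find].
exists (mkseq f (size gsB)); split; apply/matchesP; rewrite size_mkseq;
  split=> // i lti; rewrite nth_mkseq ?(proj1 (hf _ _)) ?(proj2 (hf _ _)) //;
  by rewrite -sE.
Qed.

Lemma matches_some :
  (exists2 i, i < size gsB & matches (lsB i) gsA) <->
  has (fun i => all (allowed gsA gsB false i) (iota 0 (size (lsB i)))
         && (size (lsB i) == size gsA)) (iota 0 (size gsB)).
Proof.
split=> [[i lti /matchesP[sE h]]|/hasP[i]].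
  apply/hasP; exists i; rewrite ?mem_iota0 // sE eqxx andbT.
  by apply/allP=> j; rewrite mem_iota0 => ltj; rewrite /allowed h ?andbT.
rewrite mem_iota0 => lti /andP[/allP h /eqP sE]; exists i => //.
apply/matchesP; split=> // j ltj.
by have /h/andP[] : j \in iota 0 (size (lsB i)) by rewrite mem_iota0 sE.
Qed.

Lemma matches_power (s : seq nat) : 0 < size s -> 0 < size gsA ->
  (exists k, matches (flatten (nseq k.+1 s)) gsA) <->
  (size s %| size gsA) &&
    all (fun i => nth 0 s (i %% size s) \in lsA i) (iota 0 (size gsA)).
Proof.
move=> s_gt0 A_gt0; split=> [[k /matchesP[]]|/andP[/dvdnP[[|k] kE] /allP h]].
- rewrite size_flatten_nseq => kE h; rewrite -kE dvdn_mull //=.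
  apply/allP=> i; rewrite mem_iota0 => lti.
  by rewrite -(nth_flatten_nseq (k := k.+1)) // h // -kE.
(* A zero quotient is impossible as the first expression has a set; a quotient [k.+1] is the number
   of copies. *)
- by rewrite kE in A_gt0.
exists k; apply/matchesP; rewrite size_flatten_nseq; split=> // i lti.
by rewrite nth_flatten_nseq -?kE // h // mem_iota0.
Qed.

End Answers.

(** * From expressions to groups *)

Section Regexps.
Variable sigma : nat.
Implicit Types (r : regexp 'I_sigma) (rs : seq (regexp 'I_sigma)).
Implicit Types (u ls : seq 'I_sigma).

Definition leaf_letter r : option 'I_sigma := if r is Leaf a then Some a else None.

Definition letters r : seq 'I_sigma :=
  if r is Leaf a then [:: a] else pmap leaf_letter (children r).

Definition child (t : label) r : bool :=
  is_leaf r || inner t r && all (@is_leaf _) (children r).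

(** The tags are the labels that [encode] gives to concatenation and union, less one. *)
Definition group_of r : group :=
  (match r with Leaf _ => None | Concat _ => Some 0 | _ => Some 1 end,
   map val (letters r)).

Local Notation leaves ls := (map (@Leaf 'I_sigma) ls).

Lemma all_leafE rs : all (@is_leaf _) rs -> rs = leaves (pmap leaf_letter rs).
Proof. by elim: rs => //= -[a||||] rs IH //= /IH {1}->. Qed.

Lemma pmap_leaves ls : pmap leaf_letter (leaves ls) = ls.
Proof. by elim: ls => //= a ls ->. Qed.

Lemma child_concatP r : child LConcat r ->
  (exists a, r = Leaf a) \/
  (exists2 ls, 0 < size ls & r = Concat (leaves ls)).
Proof.
case: r => [a|rs|rs|r|r] //=; first by left; exists a.
rewrite /child /inner /= => /andP[h /all_leafE E]; right.
by exists (pmap leaf_letter rs); rewrite -?E // -(size_map (@Leaf _)) -E lt0n.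
Qed.

Lemma child_unionP r : child LUnion r ->
  (exists a, r = Leaf a) \/
  (exists2 ls, 0 < size ls & r = Union (leaves ls)).
Proof.
case: r => [a|rs|rs|r|r] //=; first by left; exists a.
rewrite /child /inner /= => /andP[h /all_leafE E]; right.
by exists (pmap leaf_letter rs); rewrite -?E // -(size_map (@Leaf _)) -E lt0n.
Qed.

Lemma encode_leaves ls :
  flatten (map (@encode sigma) (leaves ls)) = letters_code (map val ls).
Proof. by elim: ls => //= a ls ->. Qed.

Lemma size_leaves ls : sumn (map (@re_size _) (leaves ls)) = size ls.
Proof. by elim: ls => //= a ls ->. Qed.

Lemma child_group t r : t = LConcat \/ t = LUnion -> child t r ->
  [/\ encode r = group_code (group_of r), wf_group (group_of r),
      0 < size (letters r) & re_size r = size (letters r)].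
Proof.
case=> -> => [/child_concatP|/child_unionP] [[a ->] //|[ls ls0 ->]];
by split; rewrite // /group_code /letters /= ?pmap_leaves
  ?size_leaves ?encode_leaves ?size_map.
Qed.

Lemma lang_leaves ls u : lang (Concat (leaves ls)) u <-> u = ls.
Proof.
elim: ls u => [|a ls IH] u /=; first by split.
split=> [[u1 [u2 [-> -> /IH->]]] //|->].
by exists [:: a], ls; split=> //; apply/IH.
Qed.

Lemma lang_child_concat r u : child LConcat r -> lang r u <-> u = letters r.
Proof.
case/child_concatP=> [[a ->] //|[ls _ ->]].
by rewrite lang_leaves /letters /= pmap_leaves.
Qed.

Lemma lang_child_union r u : child LUnion r ->
  lang r u <-> exists2 a, a \in letters r & u = [:: a].
Proof.
case/child_unionP=> [[a ->]|[ls _ ->]].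
  split=> [->|[b]]; first by exists a; rewrite // inE.
  by rewrite inE => /eqP->.
rewrite /letters /= pmap_leaves; elim: ls => [|a ls IH] /=.
  by split=> // -[].
rewrite IH; split=> [[->|[b bl ->]]|[b]].
- by exists a; rewrite // inE eqxx.
- by exists b; rewrite // inE bl orbT.
by rewrite inE => /orP[/eqP-> ->|bl ->]; [left | right; exists b].
Qed.

Lemma lang_concat_union rs u : all (child LUnion) rs ->
  lang (Concat rs) u <-> matches (map val u) (map group_of rs).
Proof.
elim: rs u => [|r rs IH] u /=; first by case: u.
case/andP=> hr /IH{}IH; split.
  case=> u1 [u2 [-> /(lang_child_union _ hr)[a al ->] /IH]] /= ->.
  by rewrite mem_map ?al //; apply: val_inj.
case: u => [|a u] //= /andP[al h]; exists [:: a], u; split=> //.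
  by apply/(lang_child_union _ hr); exists a; rewrite // -(mem_map val_inj).
exact/IH.
Qed.

(** Lets a common string of numbers be lifted to one over the alphabet: each of its letters lies in
    a group that comes from an expression. *)
Lemma matches_ord rs s :
  matches s (map group_of rs) -> exists u : seq 'I_sigma, s = map val u.
Proof.
elim: rs s => [|r rs IH] [|a s] //=; first by exists [::].
by case/andP=> /mapP[b _ ->] /IH[u ->]; exists (b :: u).
Qed.

Lemma lang_union_concat rs u : all (child LConcat) rs ->
  lang (Union rs) u <->
  exists2 i, i < size rs & map val u = nth_letters (map group_of rs) i.
Proof.
elim: rs => [|r rs IH] /=; first by split=> // -[].
case/andP=> hr /IH{}IH.
rewrite -[X in _ \/ X]/(lang (Union rs) u) IH (lang_child_concat _ hr).
split=> [[->|[i lti E]]|[[|i] lti E]].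
- by exists 0.
- by exists i.+1.
- by left; apply: (inj_map val_inj).
by right; exists i.
Qed.

Lemma lang_plus_concat r u : child LConcat r ->
  lang (Plus r) u <-> exists k, u = flatten (nseq k.+1 (letters r)).
Proof.
move=> hr; have powE k v : lang_pow (lang r) k v <-> v = flatten (nseq k (letters r)).
  elim: k v => [|k IH] v /=; first by split.
  split=> [[v1 [v2 [-> /(lang_child_concat _ hr)-> /IH->]]] //|->].
  exists (letters r), (flatten (nseq k (letters r))); split=> //.
    exact/(lang_child_concat _ hr).
  exact/IH.
by split=> -[k /powE h]; exists k.
Qed.

(** A child with at least one letter has at most two header cells and two cells per letter, hence at
    most four per letter. *)
Lemma children_groups t rs : t = LConcat \/ t = LUnion -> all (child t) rs ->
  [/\ flatten (map (@encode sigma) rs) = groups_code (map group_of rs),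
      all wf_group (map group_of rs)
    & size (groups_code (map group_of rs)) <= 4 * sumn (map (@re_size _) rs)].
Proof.
move=> ht; elim: rs => //= r rs IH /andP[/(child_group ht)[-> -> gt0 ->]].
case/IH=> -> -> le; split=> //; rewrite /groups_code /= size_cat mulnDr.
apply: leq_add => //; rewrite size_group_code /header /= size_map.
by case: r gt0 => //= *; lia.
Qed.

Lemma group_of_lt rs i j :
  i < size (map group_of rs) -> j < size (nth_letters (map group_of rs) i) ->
  nth 0 (nth_letters (map group_of rs) i) j < sigma.
Proof.
move=> lti ltj; have := mem_nth 0 ltj; move: ltj; rewrite /nth_letters.
rewrite size_map in lti; rewrite (nth_map (Concat [::])) //=.
by move=> _ /mapP[a _ ->].
Qed.

End Regexps.

(** * Word size and final assembly *)

Lemma decide_within w c k inp (ans : bool) (Q : Prop) :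
  (forall g M, g 0 = size inp -> g 1 = 0 -> intact inp M ->
     wp w c k (fun g' _ => g' 2 = 1 /\ g' 13 = ans) g M) ->
  (Q <-> ans) ->
  forall j, k + 2 <= j -> decides_within w (decide c) inp j Q.
Proof.
move=> h hQ j lej [p g M] [/= -> gE _ iM]; exists ans; last by rewrite hQ.
by apply: run_leq lej (run_decide (h _ _ _ _ iM)); rewrite gE.
Qed.

(** As [x] is at least 2, [x ^ (d + 5)] is at least [16 * x * x ^ d], while [a.+2] is at most
    [2 * x ^ d] and [N] at most [6 * x]. *)
Lemma word_size_bounds d x N w : 2 <= x -> N <= 6 * x -> x ^ (d + 5) <= 2 ^ w ->
  N.+2 < 2 ^ w /\ forall a, a < x ^ d -> a.+2 * N <= 2 ^ w.
Proof.
move=> x2 leN hw.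
have xd : 0 < x ^ d by rewrite expn_gt0; lia.
have x4 : 16 <= x ^ 4 by rewrite (leq_exp2r 2 x (e := 4)).
have le16 : x ^ d * (16 * x) <= 2 ^ w.
  by apply: leq_trans hw; rewrite expnD expnSr leq_mul2l leq_mul2r x4 !orbT.
split; first by apply: leq_trans le16; nia.
by move=> a lta; apply: leq_trans le16; nia.
Qed.

Lemma concat_union_groups sigma (A : regexp 'I_sigma) :
  homogeneous (LConcat, LUnion) A ->
  exists rs, [/\ A = Concat rs, 0 < size rs & all (child LUnion) rs].
Proof.
case: A => [a|rs|rs|r|r]; rewrite /homogeneous /inner //= => /andP[h0 h].
by exists rs; rewrite lt0n.
Qed.

Lemma leq_size_re_size sigma t (rs : seq (regexp 'I_sigma)) :
  t = LConcat \/ t = LUnion -> all (child t) rs ->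
  size rs <= sumn (map (@re_size _) rs).
Proof.
move=> ht; elim: rs => //= r rs IH /andP[/(child_group ht)[_ _ gt0 ->] /IH].
by lia.
Qed.

Theorem theorem2 (t : label * label)
    (ht : t = (LConcat, LUnion) \/ t = (LUnion, LConcat) \/ t = (LPlus, LConcat))
    (d : nat) :
  exists (P : seq instr) (c K : nat),
    forall (sigma m n : nat) (A B : regexp 'I_sigma),
      homogeneous (LConcat, LUnion) A -> re_size A = m ->
      homogeneous t B -> re_size B = n ->
      sigma <= (m + n) ^ d ->
      forall w : nat, (m + n) ^ c <= 2 ^ w ->
        decides_within w P (encode A ++ encode B) (K * (m + n))
          (exists u : seq 'I_sigma, lang A u /\ lang B u).
Proof.
(* The exponent is that of [word_size_bounds]. The programs take at most 56 steps per cell of the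
   groups, with at most 4 cells per letter, plus at most 42 steps; since [m + n] is at least 2, 300
   per letter suffices. *)
exists (decide (match t.1 with
  | LConcat => concat_union_prog
  | LUnion => union_concat_prog
  | _ => plus_concat_prog end)), (d + 5), 300.
move=> sigma m n A B hA mE hB nE hs w hw.
have [rsA [AE rsA0 cA]] := concat_union_groups hA.
have [eA wfA szA] := children_groups (or_intror erefl) cA.
have mA := leq_size_re_size (or_intror erefl) cA.
pose gsA := map (@group_of _) rsA.
have mAE : sumn (map (@re_size _) rsA) = m by rewrite -mE AE.
have encA : encode A = [:: 1, size gsA & groups_code gsA].
  by rewrite AE /= eA size_map.
rewrite mAE -/gsA in szA mA.
have smallG rs : m + n >= 2 -> size (encode A ++ encode B) <= 6 * (m + n) ->
    forall i j, i < size (map (@group_of sigma) rs) ->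
    j < size (nth_letters (map (@group_of _) rs) i) ->
    (nth 0 (nth_letters (map (@group_of _) rs) i) j).+2 *
      size (encode A ++ encode B) <= 2 ^ w.
  move=> x2 leN i j lti ltj; apply: (proj2 (word_size_bounds x2 leN hw)).
  exact: leq_trans (group_of_lt lti ltj) hs.
have langA u : lang A u <-> matches (map val u) gsA.
  by rewrite AE; apply: lang_concat_union.
have inpE : encode A ++ encode B = [:: 1, size gsA & groups_code gsA] ++ encode B.
  by rewrite encA.
case: ht hB => [|[|]] -> hB /=.
- have [rsB [BE rsB0 cB]] := concat_union_groups hB.
  have [eB wfB szB] := children_groups (or_intror erefl) cB.
  have nB := leq_size_re_size (or_intror erefl) cB.
  have nBE : sumn (map (@re_size _) rsB) = n by rewrite -nE BE.
  pose gsB := map (@group_of _) rsB; rewrite nBE -/gsB in szB nB.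
  have encB : encode B = [:: 1, size gsB & groups_code gsB].
    by rewrite BE /= eB size_map.
  have x2 : 2 <= m + n by lia.
  (* Four cells per letter, plus four for the labels and arities of the two roots, which
     [m + n >= 2] absorbs. *)
  have leN : size (encode A ++ encode B) <= 6 * (m + n).
    by rewrite size_cat encA encB /=; lia.
  have [wP _] := word_size_bounds x2 leN hw.
  apply: decide_within => [g M g0 g1 iM| |].
  + exact: (wp_concat_union_prog inpE wfA wP (smallG _ x2 leN) encB wfB
      (smallG _ x2 leN) g0 g1 iM).
  + rewrite -matches_both; split=> [[u [/langA uA]]|[s [sA sB]]].
      rewrite BE => /(lang_concat_union _ cB) uB.
      by exists (map val u).
    have [u sE] := matches_ord sA; exists u; rewrite langA -sE; split=> //.
    by rewrite BE; apply/(lang_concat_union _ cB); rewrite -sE.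
  + by rewrite mulnDr; lia.
- have [rsB [BE rsB0 cB]] : exists rs,
      [/\ B = Union rs, 0 < size rs & all (child LConcat) rs].
    case: B hB {nE inpE smallG} => [a|rs|rs|r|r];
      rewrite /homogeneous /inner //= => /andP[h0 h].
    by exists rs; rewrite lt0n.
  have [eB wfB szB] := children_groups (or_introl erefl) cB.
  have nB := leq_size_re_size (or_introl erefl) cB.
  have nBE : sumn (map (@re_size _) rsB) = n by rewrite -nE BE.
  pose gsB := map (@group_of _) rsB; rewrite nBE -/gsB in szB nB.
  have encB : encode B = [:: 2, size gsB & groups_code gsB].
    by rewrite BE /= eB size_map.
  have x2 : 2 <= m + n by lia.
  have leN : size (encode A ++ encode B) <= 6 * (m + n).
    by rewrite size_cat encA encB /=; lia.
  have [wP _] := word_size_bounds x2 leN hw.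
  apply: decide_within => [g M g0 g1 iM| |].
  + exact: (wp_union_concat_prog inpE wfA wP (smallG _ x2 leN) encB wfB
      (smallG _ x2 leN) g0 g1 iM).
  + rewrite -matches_some size_map; split=> [[u [/langA uA]]|[i lti mi]].
      rewrite BE => /(lang_union_concat _ cB)[i lti uE].
      by exists i; rewrite // -uE.
    have [u sE] := matches_ord mi; exists u; rewrite langA -sE; split=> //.
    by rewrite BE; apply/(lang_union_concat _ cB); exists i.
  + by rewrite mulnDr; lia.
- have [r [BE cr]] : exists r, B = Plus r /\ child LConcat r.
    case: B hB {nE inpE smallG} => [a|rs|rs|r|r];
      rewrite /homogeneous /inner //= andbT => h.
    by exists r.
  have [eB wfB r_gt0 szr] := child_group (or_introl erefl) cr.
  have nB : size (letters r) = n by rewrite -nE BE /= szr.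
  (* The string is viewed as a list of one child to reuse the size bound. *)
  have [_ _ szB] := children_groups (or_introl erefl)
    (rs := [:: r]) (introT andP (conj cr isT)).
  rewrite /groups_code /= cats0 addn0 szr nB in szB.
  have encB : encode B = 3 :: group_code (group_of r) by rewrite BE /= eB.
  have x2 : 2 <= m + n by lia.
  have leN : size (encode A ++ encode B) <= 6 * (m + n).
    by rewrite size_cat encA encB /=; lia.
  have [wP _] := word_size_bounds x2 leN hw.
  have x_gt0 : 0 < size (group_of r).2 by rewrite size_map.
  apply: decide_within => [g M g0 g1 iM| |].
  + exact: (wp_plus_concat_prog inpE wfA wP (smallG _ x2 leN) encB wfB x_gt0
      g0 g1 iM).
  + rewrite -matches_power ?size_map //; split=> [[u [/langA uA]]|[k mk]].
      rewrite BE => /(lang_plus_concat _ cr)[k uE]; exists k.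
      by rewrite uE map_flatten map_nseq in uA.
    exists (flatten (nseq k.+1 (letters r))); split.
      by rewrite langA map_flatten map_nseq.
    by rewrite BE; apply/(lang_plus_concat _ cr); exists k.
  + by rewrite mulnDr; lia.
Qed.
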